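(* For every operator $a\in\mathcal{B}(F)$ on a Banach space $F$ we have $$r(a)=\max_{v\in S}\lim_{n\to\infty}\|a^{*n}v\|^{\frac1n},$$ where $S$ is the unit sphere in the dual space $F^*$. Thus if $F$ is a reflexive space, the spectral exponent is always the Lyapunov exponent in some direction: there is $v\in F$ such that $$r(a)=\lim_{n\to\infty}\|a^nv\|^{\frac1n}.$$
   Context: $\mathcal{B}(F)$ is the algebra of bounded operators on $F$, $r(a)$ is the spectral radius of $a$, and $a^*\in\mathcal{B}(F^* )$ is the adjoint of $a$. *)

(* Defs.v *)
From HB Require Import structures.
From mathcomp Require Import all_boot all_order all_algebra.
From mathcomp Require Import all_classical all_reals all_analysis.
From mathcomp Require Export complex.

Set Implicit Arguments.
Unset Strict Implicit.
Unset Printing Implicit Defensive.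

Import Order.TTheory GRing.Theory Num.Theory.
Import numFieldNormedType.Exports.

Local Open Scope complex_scope.
Local Open Scope classical_set_scope.
Local Open Scope ring_scope.

(* The norm of a normedModType over R[i] takes its (real) values in R[i];
   rnorm is the same norm read in R. *)
Definition rnorm (R : realType) (E : normedModType R[i]) (x : E) : R :=
  complex.Re `|x|.

Section RNorm.
Context {R : realType} {E : normedModType R[i]}.
Implicit Types x y : E.

Lemma rnormE x : `|x| = (rnorm x)%:C.
Proof. by rewrite /rnorm RRe_real. Qed.

Lemma rnorm_ge0 x : 0 <= rnorm x.
Proof. by rewrite -lecR -rnormE rmorph0. Qed.

Lemma rnorm0 : rnorm (0 : E) = 0.
Proof. by rewrite /rnorm normr0. Qed.

Lemma rnorm_eq0 x : rnorm x = 0 -> x = 0.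
Proof. by move=> x0; apply/eqP; rewrite -normr_eq0 rnormE x0. Qed.

Lemma ler_rnormD x y : rnorm (x + y) <= rnorm x + rnorm y.
Proof. by rewrite -lecR rmorphD/= -!rnormE ler_normD. Qed.

Lemma rnormZ (k : R[i]) x : rnorm (k *: x) = complex.Re `|k| * rnorm x.
Proof.
apply: (@complexI R); rewrite rmorphM/= -!rnormE normrZ.
by congr (_ * _); rewrite RRe_real.
Qed.

End RNorm.

Section BoundedOperators.
Context {R : realType} {E G : normedModType R[i]}.

Definition bounded_linear (f : E -> G) : Prop :=
  linear f /\ exists M : R, forall x, rnorm (f x) <= M * rnorm x.

Definition is_bounded_linear : {pred E -> G} := [pred f | `[< bounded_linear f >]].

Lemma is_bounded_linear_subsemimod : GRing.subsemimod_closed is_bounded_linear.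
Proof.
split; [split|].
- apply/asboolP; split; first by move=> k x y; rewrite scaler0 addr0.
  by exists 0 => x; rewrite rnorm0 mul0r.
- move=> f g /asboolP[lf [M fM]] /asboolP[lg [N gN]]; apply/asboolP; split.
    move=> k x y; rewrite !fctE lf lg scalerDr.
    by rewrite -!addrA; congr (_ + _); rewrite addrCA.
  exists (M + N) => x; rewrite fctE (le_trans (ler_rnormD _ _))//.
  by rewrite mulrDl lerD.
- move=> k f /asboolP[lf [M fM]]; apply/asboolP; split.
    by move=> c x y; rewrite !fctE lf scalerDr !scalerA mulrC.
  exists (complex.Re `|k| * M) => x; rewrite fctE rnormZ -mulrA ler_wpM2l//.
  exact: (@rnorm_ge0 R R[i]^o k).
Qed.

End BoundedOperators.

Record bop (R : realType) (E G : normedModType R[i]) :=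
  Bop { bop_fun :> E -> G ; bop_funP : bop_fun \in is_bounded_linear }.

Section BopLmodule.
Context {R : realType} {E G : normedModType R[i]}.

HB.instance Definition _ := [isSub for (@bop_fun R E G)].
HB.instance Definition _ := [Choice of bop E G by <:].
HB.instance Definition _ := GRing.SubChoice_isSubLmodule.Build R[i] (E -> G)
  is_bounded_linear (bop E G) is_bounded_linear_subsemimod.

Implicit Types f g : bop E G.

Lemma bopP f : bounded_linear f.
Proof. exact/asboolP/bop_funP. Qed.

Lemma bop_linear f : linear f.
Proof. by case: (bopP f). Qed.

Lemma bop_eq f g : (forall x, f x = g x) -> f = g.
Proof. by move=> fg; apply: val_inj; apply/funext. Qed.

Lemma bopD f g x : (f + g) x = f x + g x.
Proof. by []. Qed.

Lemma bopZ k f x : (k *: f) x = k *: f x.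
Proof. by []. Qed.

HB.instance Definition _ f := GRing.isLinear.Build R[i] E G _ f (bop_linear f).

Definition opnorm f : R := sup [set rnorm (f x) | x in [set x | rnorm x <= 1]].

Lemma opnorm_has_sup f :
  has_sup [set rnorm (f x) | x in [set x | rnorm x <= 1]].
Proof.
split; first by exists (rnorm (f 0)), 0 => //=; rewrite rnorm0.
have [_ [M fM]] := bopP f; exists `|M| => _ /= [x x1 <-].
rewrite (le_trans (fM x))// (le_trans (ler_norm _))// normrM ler_piMr//.
by rewrite ger0_norm// rnorm_ge0.
Qed.

Lemma ler_opnorm_ball f x : rnorm x <= 1 -> rnorm (f x) <= opnorm f.
Proof. by move=> x1; apply: (ub_le_sup (opnorm_has_sup f).2); exists x. Qed.

Lemma opnorm_le f (M : R) :
  (forall x, rnorm x <= 1 -> rnorm (f x) <= M) -> opnorm f <= M.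
Proof.
by move=> fM; apply: ge_sup (opnorm_has_sup f).1 _ => _ [x x1 <-]; exact: fM.
Qed.

Lemma opnorm_ge0 f : 0 <= opnorm f.
Proof.
by apply: le_trans (rnorm_ge0 (f 0)) _; rewrite ler_opnorm_ball// rnorm0.
Qed.

Lemma ler_opnorm f x : rnorm (f x) <= opnorm f * rnorm x.
Proof.
have [x0|x0] := eqVneq (rnorm x) 0.
  by rewrite (rnorm_eq0 x0) linear0 !rnorm0 mulr0.
have x_gt0 : 0 < rnorm x by rewrite lt_def x0 rnorm_ge0.
have xVE : complex.Re `|(rnorm x)^-1%:C| = (rnorm x)^-1.
  by rewrite ger0_norm// lecR invr_ge0 ltW.
rewrite -ler_pdivrMr// mulrC -[(rnorm x)^-1]xVE -rnormZ -linearZ/=.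
by apply: ler_opnorm_ball; rewrite rnormZ xVE mulVf.
Qed.

Lemma ler_opnormD f g : (opnorm (f + g))%:C <= (opnorm f)%:C + (opnorm g)%:C.
Proof.
rewrite -rmorphD lecR; apply: opnorm_le => x x1.
by rewrite bopD (le_trans (ler_rnormD _ _))// lerD// ler_opnorm_ball.
Qed.

Lemma opnormZ k f : (opnorm (k *: f))%:C = `|k| * (opnorm f)%:C.
Proof.
have kE : `|k| = (complex.Re `|k|)%:C by rewrite RRe_real.
have opnormZ_le c g : opnorm (c *: g) <= complex.Re `|c| * opnorm g.
  apply: opnorm_le => x x1; rewrite bopZ rnormZ ler_wpM2l//.
    exact: (@rnorm_ge0 R R[i]^o c).
  exact: ler_opnorm_ball.
have [->|k0] := eqVneq k 0.
  rewrite normr0 mul0r scale0r; congr _%:C; apply/eqP.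
  rewrite eq_le opnorm_ge0 andbT; apply: opnorm_le => x _.
  by rewrite -(scale0r f) bopZ scale0r rnorm0.
have ck_gt0 : 0 < complex.Re `|k|.
  by rewrite -ltcR -kE normr_gt0.
rewrite kE -rmorphM; congr _%:C; apply/eqP; rewrite eq_le opnormZ_le/=.
rewrite -ler_pdivlMl//.
have := opnormZ_le k^-1 (k *: f); rewrite scalerA mulVf// scale1r.
suff -> : complex.Re `|k^-1| = (complex.Re `|k|)^-1 by [].
by rewrite normfV {1}kE -fmorphV.
Qed.

Lemma opnorm_eq0 f : (opnorm f)%:C = 0 -> f = 0.
Proof.
move=> /complexI f0; apply: bop_eq => x; apply: rnorm_eq0; apply/eqP.
by rewrite eq_le rnorm_ge0 andbT (le_trans (ler_opnorm f x))// f0 mul0r.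
Qed.

HB.instance Definition _ := Lmodule_isNormed.Build R[i] (bop E G)
  ler_opnormD opnormZ opnorm_eq0.

Lemma rnorm_bopE f : rnorm f = opnorm f.
Proof. by []. Qed.

End BopLmodule.

Section Spectrum.
Context {R : realType} {E : normedModType R[i]}.

Lemma bop_id_subproof : (idfun : E -> E) \in is_bounded_linear.
Proof.
by apply/asboolP; split=> //; exists 1 => x; rewrite mul1r.
Qed.
Definition bop_id : bop E E := Bop bop_id_subproof.

Definition bop_invertible (a : bop E E) : Prop :=
  exists b : bop E E, cancel a b /\ cancel b a.

Definition spectrum (a : bop E E) : set R[i] :=
  [set z | ~ bop_invertible (z *: bop_id - a)].

(* For E = 0 the spectrum is empty and this supremum takes the value 0. *)
Definition spectral_radius (a : bop E E) : R :=
  sup [set complex.Re `|z| | z in spectrum a].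

End Spectrum.

Section Dual.
Context {R : realType}.

Definition dual_space (E : normedModType R[i]) : normedModType R[i] :=
  bop E (R[i]^o : normedModType R[i]).

Context {E : normedModType R[i]}.

Lemma pullback_subproof (a : bop E E) (v : dual_space E) :
  (v \o a : E -> R[i]^o) \in is_bounded_linear.
Proof.
apply/asboolP; split; first by move=> k x y; rewrite /= !linearP.
exists (opnorm v * opnorm a) => x.
rewrite (le_trans (ler_opnorm v _))// -mulrA ler_wpM2l ?opnorm_ge0//.
exact: ler_opnorm.
Qed.
Definition pullback (a : bop E E) (v : dual_space E) : dual_space E :=
  Bop (pullback_subproof a v).

Lemma adjoint_subproof (a : bop E E) : pullback a \in is_bounded_linear.
Proof.
apply/asboolP; split; first by move=> k v w; apply: bop_eq.
exists (opnorm a) => v; apply: opnorm_le => x x1 /=.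
rewrite (le_trans (ler_opnorm v _))// mulrC ler_wpM2r ?opnorm_ge0//.
exact: ler_opnorm_ball.
Qed.

Definition adjoint (a : bop E E) : bop (dual_space E) (dual_space E) :=
  Bop (adjoint_subproof a).

Lemma evaluation_subproof (x : E) :
  ((fun v : dual_space E => v x) : dual_space E -> R[i]^o) \in is_bounded_linear.
Proof.
apply/asboolP; split=> //; exists (rnorm x) => v.
by rewrite mulrC; exact: ler_opnorm.
Qed.

Definition bidual_embedding (x : E) : dual_space (dual_space E) :=
  Bop (evaluation_subproof x).

End Dual.

Definition reflexive_space (R : realType) (E : normedModType R[i]) : Prop :=
  forall phi : dual_space (dual_space E), exists x : E, bidual_embedding x = phi.

Definition growth_rate (R : realType) (E : normedModType R[i])
    (a : bop E E) (v : E) (l : R) : Prop :=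
  rnorm (iter n a v) `^ n%:R^-1 @[n --> \oo] --> l.

(* The limit need not exist for every v, so the maximum of
   lim |a^n v|^(1/n) over v in S is taken over those v in S for which it does. *)
Definition is_max_growth_rate (R : realType) (E : normedModType R[i])
    (a : bop E E) (S : set E) (l : R) : Prop :=
  let rates := [set m | exists2 v, S v & growth_rate a v m] in
  rates l /\ ubound rates l.

Definition unit_sphere (R : realType) (E : normedModType R[i]) : set E :=
  [set v | rnorm v = 1].

(* Main.v *)
(* The adjoint is an operator on a Banach space with r(a) as growth rate of the
   norms of its powers, so it is enough to find, for T on a Banach space whose
   powers satisfy |T^n| >= r^n and |T^n| = O(s^n) for all s > r, a vector v with
   |T^n v|^(1/n) -> r.  Put n_j = j^2 and sum a series whose j-th term is 0 or
   16^-j times a vector nearly norming T^(n_j): choosing between the two avoids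
   cancellation in T^(n_j) v, and the tail is negligible, so that
   |T^(n_j) v| >= const * 16^-j |T^(n_j)|.  Since n_(j+1) - n_j = O(sqrt n_j), this
   controls all times up to a factor d^(sqrt n), which the n-th root kills.
   That the spectral radius is the growth rate is Gelfand's formula, proved by
   Rickart's averaging over roots of unity, and |a^*n| = |a^n| is the
   Hahn-Banach theorem. *)
From HB Require Import structures.
Require Import Defs.
From mathcomp Require Import all_boot all_order all_algebra.
From mathcomp Require Import all_classical all_reals all_analysis.
From mathcomp Require Import complex ring lra.

Set Implicit Arguments.
Unset Strict Implicit.
Unset Printing Implicit Defensive.

Import Order.TTheory GRing.Theory Num.Theory.
Import numFieldNormedType.Exports.

Local Open Scope complex_scope.
Local Open Scope classical_set_scope.
Local Open Scope ring_scope.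

(** * The modulus of a complex number as a real number *)

Section Modulus.
Context {R : realType}.
Implicit Types z w : R[i].

Definition cabs z : R := complex.Re `|z|.

Lemma cabsE z : (cabs z)%:C = `|z|.
Proof. by rewrite /cabs RRe_real. Qed.

Lemma cabs_ge0 z : 0 <= cabs z.
Proof. exact: (@rnorm_ge0 R R[i]^o z). Qed.

Lemma cabsM z w : cabs (z * w) = cabs z * cabs w.
Proof. by apply: (@complexI R); rewrite rmorphM/= !cabsE normrM. Qed.

Lemma cabs1 : cabs 1 = 1.
Proof. by apply: (@complexI R); rewrite cabsE normr1. Qed.

Lemma cabs0 : cabs 0 = 0.
Proof. by apply: (@complexI R); rewrite cabsE normr0. Qed.

Lemma cabsX z n : cabs (z ^+ n) = cabs z ^+ n.
Proof. by apply: (@complexI R); rewrite rmorphXn/= !cabsE normrX. Qed.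

Lemma cabsV z : cabs z^-1 = (cabs z)^-1.
Proof. by apply: (@complexI R); rewrite fmorphV/= !cabsE normfV. Qed.

Lemma cabs_eq0 z : (cabs z == 0) = (z == 0).
Proof. by rewrite -(normr_eq0 z) -cabsE -(inj_eq (@complexI R)). Qed.

Lemma ler_cabsD z w : cabs (z + w) <= cabs z + cabs w.
Proof. exact: (@ler_rnormD R R[i]^o z w). Qed.

Lemma cabsC (x : R) : cabs x%:C = `|x|.
Proof.
by apply: (@complexI R); rewrite cabsE normc_def/= expr0n addr0 sqrtr_sqr.
Qed.

Lemma cabsi : cabs ('i%C : R[i]) = 1.
Proof.
by apply: (@complexI R); rewrite cabsE normc_def/= expr0n expr1n add0r sqrtr1.
Qed.

Lemma cabs_le_ReIm z : cabs z <= `|complex.Re z| + `|complex.Im z|.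
Proof.
rewrite [in cabs z](complexE z) (le_trans (ler_cabsD _ _))//.
by rewrite cabsM cabsi mul1r !cabsC.
Qed.

Lemma Re_le_cabs z : `|complex.Re z| <= cabs z.
Proof. by rewrite -lecR cabsE normc_ge_Re. Qed.

Lemma Im_le_cabs z : `|complex.Im z| <= cabs z.
Proof.
have := Re_le_cabs (z * 'i%C); rewrite ReiNIm normrN.
by rewrite cabsM cabsi mulr1.
Qed.

End Modulus.

Section RnormTheory.
Context {R : realType} {E : normedModType R[i]}.
Implicit Types x y : E.

Lemma rnormZE (k : R[i]) x : rnorm (k *: x) = cabs k * rnorm x.
Proof. exact: rnormZ. Qed.

Lemma rnormN x : rnorm (- x) = rnorm x.
Proof. by rewrite /rnorm normrN. Qed.

Lemma ler_rnormB x y : rnorm (x - y) <= rnorm x + rnorm y.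
Proof. by rewrite (le_trans (ler_rnormD _ _))// rnormN. Qed.

Lemma ler_rnorm_sub x y : rnorm x - rnorm y <= rnorm (x - y).
Proof. by rewrite lerBlDr -{1}(subrK y x) ler_rnormD. Qed.

Lemma rnorm_distC x y : rnorm (x - y) = rnorm (y - x).
Proof. by rewrite -rnormN opprB. Qed.

Lemma rnorm_gt0 x : x != 0 -> 0 < rnorm x.
Proof.
move=> x0; rewrite lt_neqAle rnorm_ge0 andbT eq_sym.
by apply: contra_neq x0 => /rnorm_eq0.
Qed.

End RnormTheory.

(** * The ring of bounded operators *)

Section BopRing.
Context {R : realType} {E : normedModType R[i]}.
Implicit Types f g h : bop E E.

Lemma bop_sub f x y : f (x - y) = f x - f y. Proof. exact: linearB. Qed.

Lemma bop_mul_subproof f g : (f \o g : E -> E) \in is_bounded_linear.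
Proof.
apply/asboolP; split; first by move=> k x y; rewrite /= !linearP.
exists (opnorm f * opnorm g) => x.
rewrite (le_trans (ler_opnorm f _))// -mulrA ler_wpM2l ?opnorm_ge0//.
exact: ler_opnorm.
Qed.
Definition bop_mul f g : bop E E := Bop (bop_mul_subproof f g).

Lemma bop_mulA : associative bop_mul. Proof. by move=> f g h; exact: bop_eq. Qed.
Lemma bop_mul1 : left_id bop_id bop_mul. Proof. by move=> f; exact: bop_eq. Qed.
Lemma bop_mulr1 : right_id bop_id bop_mul. Proof. by move=> f; exact: bop_eq. Qed.
Lemma bop_mulDl : left_distributive bop_mul +%R.
Proof. by move=> f g h; exact: bop_eq. Qed.
Lemma bop_mulDr : right_distributive bop_mul +%R.
Proof. by move=> f g h; apply: bop_eq => x; exact: linearD. Qed.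

HB.instance Definition _ := GRing.Zmodule_isPzRing.Build (bop E E)
  bop_mulA bop_mul1 bop_mulr1 bop_mulDl bop_mulDr.

Lemma bopM f g x : (f * g) x = f (g x). Proof. by []. Qed.
Lemma bop1 x : (1 : bop E E) x = x. Proof. by []. Qed.
Lemma bopX f n x : (f ^+ n) x = iter n f x.
Proof. by elim: n x => [|n IH] x; rewrite ?expr0// exprS bopM IH. Qed.

Lemma bop_scaleAl (k : R[i]) f g : k *: (f * g) = (k *: f) * g.
Proof. exact: bop_eq. Qed.

Lemma bop_scaleAr (k : R[i]) f g : k *: (f * g) = f * (k *: g).
Proof. by apply: bop_eq => x; rewrite bopZ bopM -linearZ. Qed.

Lemma bop_scaleX (k : R[i]) f n : (k *: f) ^+ n = k ^+ n *: f ^+ n.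
Proof.
elim: n => [|n IH]; first by rewrite !expr0 scale1r.
by rewrite !exprS IH -bop_scaleAl -bop_scaleAr scalerA.
Qed.

Lemma opnormM f g : opnorm (f * g) <= opnorm f * opnorm g.
Proof.
apply: opnorm_le => x x1; rewrite bopM (le_trans (ler_opnorm f _))//.
by rewrite ler_wpM2l ?opnorm_ge0// ler_opnorm_ball.
Qed.

Lemma opnorm1_le : opnorm (1 : bop E E) <= 1.
Proof. by apply: opnorm_le. Qed.

Lemma opnormX f n : opnorm (f ^+ n) <= opnorm f ^+ n.
Proof.
elim: n => [|n IH]; first by rewrite !expr0 opnorm1_le.
by rewrite !exprS (le_trans (opnormM _ _))// ler_wpM2l ?opnorm_ge0.
Qed.

Lemma opnormZE (k : R[i]) f : opnorm (k *: f) = cabs k * opnorm f.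
Proof. by apply: (@complexI R); rewrite opnormZ rmorphM/= cabsE. Qed.

Lemma opnormD_le f g : opnorm (f + g) <= opnorm f + opnorm g.
Proof. by rewrite -lecR rmorphD ler_opnormD. Qed.

Lemma opnormN f : opnorm (- f) = opnorm f.
Proof. exact: (@rnormN R (bop E E) f). Qed.

Definition is_inverse f g := f * g = 1 /\ g * f = 1.

Lemma is_inverse_invertible f g : is_inverse f g -> bop_invertible f.
Proof.
move=> [fg gf]; exists g; split=> x.
  by rewrite -bopM gf.
by rewrite -bopM fg.
Qed.

Lemma bop_invertibleP f : bop_invertible f <-> exists g, is_inverse f g.
Proof.
split=> [[g [fK gK]]|[g]]; last exact: is_inverse_invertible.
by exists g; split; apply: bop_eq => x; rewrite bopM ?fK ?gK.
Qed.

Lemma is_inverse_lr f g h : f * g = 1 -> h * f = 1 -> is_inverse f g.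
Proof.
move=> fg hf; split=> //; suff -> : g = h by [].
by rewrite -[g]mul1r -hf -mulrA fg mulr1.
Qed.

Lemma is_inverseM f f' g g' :
  is_inverse f g -> is_inverse f' g' -> is_inverse (f * f') (g' * g).
Proof.
move=> [fg gf] [fg' gf']; split.
  by rewrite mulrA -(mulrA f) fg' mulr1.
by rewrite mulrA -(mulrA g') gf mulr1.
Qed.

Lemma is_inverseZ (k : R[i]) f g : k != 0 ->
  is_inverse f g -> is_inverse (k *: f) (k^-1 *: g).
Proof.
move=> k0 [fg gf]; split; rewrite -bop_scaleAl -bop_scaleAr scalerA.
  by rewrite divff// scale1r.
by rewrite mulVf// scale1r.
Qed.

End BopRing.

(** * Completeness and Neumann series *)

Section GeometricCompleteness.
Context {R : realType}.

Lemma geometric_le0 (c K q : R) : 0 <= q -> q < 1 ->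
  (forall n, c <= K * q ^+ n) -> c <= 0.
Proof.
move=> q0 q1 cK.
have : (fun n => K * q ^+ n) @ \oo --> (0 : R).
  by rewrite -[X in _ --> X](mulr0 K); apply: cvgMr; apply: cvg_expr; rewrite ger0_norm.
by move=> /cvgr_to_ge; apply; exact: nearW.
Qed.

(* Cauchy sequences with geometrically small steps are the only ones needed,
   and for them completeness passes to duals by elementary means. *)
Definition geom_complete (E : normedModType R[i]) : Prop :=
  forall (x : nat -> E) (C q : R), 0 <= q -> q < 1 ->
    (forall n, rnorm (x n.+1 - x n) <= C * q ^+ n) ->
  exists l, exists K, forall n, rnorm (l - x n) <= K * q ^+ n.

Lemma geometric_dist (E : normedModType R[i]) (x : nat -> E) (C q : R) :
  0 <= q -> q < 1 -> (forall n, rnorm (x n.+1 - x n) <= C * q ^+ n) ->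
  forall n k, rnorm (x (n + k)%N - x n) <= C / (1 - q) * q ^+ n.
Proof.
move=> q0 q1 xC n k.
have q1' : 0 < 1 - q by rewrite subr_gt0.
have C0 : 0 <= C by have := le_trans (rnorm_ge0 _) (xC 0%N); rewrite expr0 mulr1.
(* The factor [1 - q ^+ k] turns the bound into the exact partial geometric sum, which makes the
   induction on k close. *)
suff : rnorm (x (n + k)%N - x n) <= C / (1 - q) * q ^+ n * (1 - q ^+ k).
  move=> /le_trans; apply; rewrite ler_piMr//.
    by rewrite mulr_ge0 ?exprn_ge0// divr_ge0// ltW.
  by rewrite gerBl exprn_ge0.
elim: k => [|k IH]; first by rewrite addn0 subrr rnorm0 expr0 subrr mulr0.
rewrite addnS -(subrKA (x (n + k)%N)) (le_trans (ler_rnormD _ _))//.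
apply: le_trans (lerD (xC _) IH) _; rewrite exprD exprS le_eqVlt; apply/orP; left.
by apply/eqP; field; rewrite gt_eqF.
Qed.

(** Going through [x (n + k)] and letting k grow replaces the unspecified [K] by a constant that
    depends only on the step sizes. *)
Lemma geometric_tail (E : normedModType R[i]) (x : nat -> E) (l : E) (C K q : R) :
  0 <= q -> q < 1 -> (forall n, rnorm (x n.+1 - x n) <= C * q ^+ n) ->
  (forall n, rnorm (l - x n) <= K * q ^+ n) ->
  forall n, rnorm (l - x n) <= C / (1 - q) * q ^+ n.
Proof.
move=> q0 q1 xC xK n; rewrite -subr_le0.
apply: (@geometric_le0 _ (K * q ^+ n) q q0 q1) => k.
rewrite lerBlDr -mulrA -exprD -(subrKA (x (n + k)%N)) (le_trans (ler_rnormD _ _))//.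
by apply: lerD; [exact: xK|exact: geometric_dist].
Qed.

Lemma complete_geom_complete (F : completeNormedModType R[i]) : geom_complete F.
Proof.
move=> x C q q0 q1 xC.
have dx := geometric_dist q0 q1 xC.
set B := C / (1 - q) in dx.
have B0 : 0 <= B by have := le_trans (rnorm_ge0 _) (dx 0%N 0%N); rewrite expr0 mulr1.
have cB : (fun n => B * q ^+ n) @ \oo --> (0 : R).
  by rewrite -[X in _ --> X](mulr0 B); apply: cvgMr; apply: cvg_expr; rewrite ger0_norm.
have : cauchy (x @ \oo).
  apply/cauchyP => e e0.
  have eE : e = (complex.Re e)%:C by rewrite RRe_real// ger0_real// ltW.
  have e'0 : 0 < complex.Re e by rewrite -ltcR -eE.
  have [N _ HN] := cvgr_lt (0 : R) cB _ e'0.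
  exists (x N); exists N => // n /= Nn.
  rewrite -ball_normE/= distrC rnormE eE ltcR -(subnKC Nn).
  by apply: le_lt_trans (dx _ _) _; apply: HN => /=.
move/cauchy_cvgP => /cvg_ex[l xl]; exists l, B => n.
apply/ler_addgt0Pr => e e0.
have : \forall k \near \oo, rnorm (l - x k) < e.
  have e0' : 0 < e%:C by rewrite ltcR.
  move/cvgrPdist_lt : xl => /(_ _ e0').
  by apply: filterS => k; rewrite rnormE ltcR.
move=> [N _ HN]; have := HN (n + N)%N (leq_addl _ _) => lx.
rewrite -(subrKA (x (n + N)%N)) (le_trans (ler_rnormD _ _))// addrC.
by apply: lerD; [exact: dx|exact: ltW].
Qed.

(** With [B = C / (1 - q)] the intervals of radius [B * q ^+ n] around [u n] are nested; the limit
    is the supremum of their lower ends. *)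
Lemma real_geom_complete (u : nat -> R) (C q : R) : 0 <= q -> q < 1 ->
    (forall n, `|u n.+1 - u n| <= C * q ^+ n) ->
  exists l, forall n, `|l - u n| <= C / (1 - q) * q ^+ n.
Proof.
move=> q0 q1 uC; set B := C / (1 - q).
have q1' : 0 < 1 - q by rewrite subr_gt0.
have BE : C = B * (1 - q) by rewrite /B divfK// gt_eqF.
pose lo n := u n - B * q ^+ n; pose up n := u n + B * q ^+ n.
have loS n : lo n <= lo n.+1.
  have := uC n; rewrite /lo exprS BE ler_norml => /andP[+ _]; lra.
have upS n : up n.+1 <= up n.
  have := uC n; rewrite /up exprS BE ler_norml => /andP[_]; lra.
have lo_up n : lo n <= up n.
  have := le_trans (normr_ge0 _) (uC n).
  rewrite BE mulrAC pmulr_lge0// /lo /up; lra.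
have lo_mono m n : (m <= n)%N -> lo m <= lo n.
  by move=> mn; rewrite -(subnKC mn); elim: (n - m)%N => [|k IH];
    rewrite ?addn0// addnS (le_trans IH).
have up_mono m n : (m <= n)%N -> up n <= up m.
  by move=> mn; rewrite -(subnKC mn); elim: (n - m)%N => [|k IH];
    rewrite ?addn0// addnS (le_trans _ IH).
have ub n : ubound (range lo) (up n).
  move=> _ [m _ <-]; rewrite (le_trans (lo_mono m (maxn m n) _)) ?leq_maxl//.
  by rewrite (le_trans (lo_up _))// up_mono// leq_maxr.
have lo_sup : has_sup (range lo) by split; [exists (lo 0%N), 0%N|exists (up 0%N)].
exists (sup (range lo)) => n; rewrite ler_norml; apply/andP; split.
  rewrite lerBrDr addrC; apply: (ub_le_sup lo_sup.2); by exists n.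
by rewrite lerBlDl; apply: ge_sup (ub n); exact: lo_sup.1.
Qed.

Lemma scalar_geom_complete : geom_complete (R[i]^o : normedModType R[i]).
Proof.
move=> x C q q0 q1 xC.
have [n|a aP] := @real_geom_complete (fun n => complex.Re (x n)) C q q0 q1.
  rewrite -raddfB (le_trans (Re_le_cabs _))//; exact: xC.
have [n|b bP] := @real_geom_complete (fun n => complex.Im (x n)) C q q0 q1.
  rewrite -raddfB (le_trans (Im_le_cabs _))//; exact: xC.
exists (a +i* b : R[i]), (C / (1 - q) + C / (1 - q)) => n.
apply: le_trans (cabs_le_ReIm _) _; rewrite mulrDl.
by apply: lerD; rewrite raddfB/=.
Qed.

(** The limit is taken pointwise. [geometric_tail] makes the error proportional to [rnorm x], so
    convergence holds in the dual norm. *)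
Lemma dual_geom_complete (E : normedModType R[i]) : geom_complete (dual_space E).
Proof.
move=> v C q q0 q1 vC.
have q1' : 0 < 1 - q by rewrite subr_gt0.
have vx x n : rnorm (v n.+1 x - v n x : R[i]^o) <= (C * rnorm x) * q ^+ n.
  rewrite mulrAC (le_trans (ler_opnorm (v n.+1 - v n) x))//.
  by rewrite ler_wpM2r ?rnorm_ge0//; exact: vC.
have /choice[l lP] : forall x, exists z : R[i]^o,
    forall n, rnorm (z - v n x) <= C / (1 - q) * rnorm x * q ^+ n.
  move=> x; have [z [K zK]] := scalar_geom_complete q0 q1 (vx x).
  exists z => n; have := geometric_tail q0 q1 (vx x) zK n.
  by rewrite (mulrAC C (rnorm x)).
have C0 : 0 <= C.
  by have := le_trans (rnorm_ge0 _) (vC 0%N); rewrite expr0 mulr1.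
have ll : linear l.
  move=> k x y; apply/eqP; rewrite -subr_eq0; apply/eqP/rnorm_eq0/eqP.
  rewrite eq_le rnorm_ge0 andbT.
  (* The defect of linearity is at most a constant times [q ^+ n] for every n, hence zero. *)
  apply: (@geometric_le0 _ (C / (1 - q) * rnorm (k *: x + y) +
    (cabs k * (C / (1 - q) * rnorm x) + C / (1 - q) * rnorm y)) q q0 q1) => n.
  have -> : l (k *: x + y) - (k *: l x + l y) = (l (k *: x + y) - v n (k *: x + y))
     - (k *: (l x - v n x) + (l y - v n y)).
    rewrite (bop_linear (v n)) scalerBr; move: (k *: l x) (k *: v n x) => p r.
    by ring.
  rewrite mulrDl (le_trans (ler_rnormB _ _))// lerD//.
  rewrite mulrDl (le_trans (ler_rnormD _ _))// lerD//.
  by rewrite rnormZE -mulrA ler_wpM2l// cabs_ge0.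
have lb : (l : E -> R[i]^o) \in is_bounded_linear.
  apply/asboolP; split=> //; exists (C / (1 - q) + opnorm (v 0%N)) => x.
  have := lP x 0%N; rewrite expr0 mulr1 mulrDl => lx.
  rewrite -[l x](subrK (v 0%N x)) (le_trans (ler_rnormD _ _))// lerD//.
  exact: ler_opnorm.
exists (Bop lb : dual_space E), (C / (1 - q)) => n.
apply: opnorm_le => x x1; apply: le_trans (lP x n) _.
rewrite mulrAC ler_piMr// mulr_ge0 ?exprn_ge0//.
by rewrite divr_ge0// ltW.
Qed.

End GeometricCompleteness.

Section Neumann.
Context {R : realType} {E : normedModType R[i]}.
Implicit Types b f g h k : bop E E.

(** The lower bound gives injectivity, and [K] is then a bound for the inverse. *)
Lemma bounded_below_surj_invertible b (K : R) :
  (forall x, rnorm x <= K * rnorm (b x)) -> (forall y, exists x, b x = y) ->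
  exists g, is_inverse b g.
Proof.
move=> bK /choice[g gP].
have binj x y : b x = b y -> x = y.
  move=> bxy; apply/eqP; rewrite -subr_eq0; apply/eqP/rnorm_eq0/eqP.
  rewrite eq_le rnorm_ge0 andbT (le_trans (bK _))//.
  by rewrite bop_sub bxy subrr rnorm0 mulr0.
have gb : (g : E -> E) \in is_bounded_linear.
  apply/asboolP; split; last by exists K => x; rewrite (le_trans (bK _))// gP.
  by move=> k x y; apply: binj; rewrite (bop_linear b) !gP.
exists (Bop gb); split; apply: bop_eq => x; rewrite bopM bop1/= ?gP//.
by apply: binj; rewrite gP.
Qed.

Lemma geometric_telescope b n :
  (1 - b) * (\sum_(i < n) b ^+ i) = 1 - b ^+ n.
Proof. by rewrite -opprB mulNr -subrX1 opprB. Qed.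

Lemma geometric_telescopeC b n :
  (\sum_(i < n) b ^+ i) * (1 - b) = 1 - b ^+ n.
Proof.
rewrite -geometric_telescope mulrBl mulrBr mul1r mulr1; congr (_ - _).
by rewrite mulr_sumr mulr_suml; apply: eq_bigr => i _; rewrite -exprS exprSr.
Qed.

Hypothesis E_complete : geom_complete E.

(** [1 - b] is bounded below by [1 - opnorm b]. Preimages of y are found by summing the vectors
    [(b ^+ i) y], so completeness of [E] suffices. *)
Lemma neumann b : opnorm b < 1 -> exists g, is_inverse (1 - b) g.
Proof.
move=> b1; have b0 := opnorm_ge0 b.
apply: (@bounded_below_surj_invertible _ (1 - opnorm b)^-1).
  move=> x; rewrite ler_pdivlMl ?subr_gt0// mulrBl mul1r.
  rewrite (le_trans _ (ler_rnorm_sub _ _))// lerD2l lerN2.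
  exact: ler_opnorm.
move=> y; pose x n := (\sum_(i < n) b ^+ i) y.
have [n|l [K lK]] := E_complete (x := x) (C := rnorm y) b0 b1.
  have -> : x n.+1 - x n = (b ^+ n) y.
    by rewrite /x big_ord_recr bopD addrAC subrr add0r.
  rewrite mulrC (le_trans (ler_opnorm _ _))// ler_wpM2r ?rnorm_ge0//.
  exact: opnormX.
exists l; apply/eqP; rewrite -subr_eq0; apply/eqP/rnorm_eq0/eqP.
rewrite eq_le rnorm_ge0 andbT.
apply: (@geometric_le0 R _ (opnorm (1 - b) * K + rnorm y) _ b0 b1) => n.
have -> : (1 - b) l - y = (1 - b) (l - x n) - (b ^+ n) y.
  rewrite bop_sub /x -bopM geometric_telescope.
  by rewrite -[(1 - b ^+ n) y]/(y - (b ^+ n) y) opprB addrA (addrAC (_ + _)) addrK.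
rewrite mulrDl (le_trans (ler_rnormB _ _))// lerD//.
  by rewrite -mulrA (le_trans (ler_opnorm _ _))// ler_wpM2l ?opnorm_ge0.
rewrite mulrC (le_trans (ler_opnorm _ _))// ler_wpM2r ?rnorm_ge0//.
exact: opnormX.
Qed.

(** The identity [g = 1 + g * b] bounds [opnorm g] by [1 + opnorm g * q]. *)
Lemma neumann_bound b g (q : R) : opnorm b <= q -> q < 1 ->
  is_inverse (1 - b) g -> opnorm g <= (1 - q)^-1.
Proof.
move=> bq q1 [_ gb]; rewrite -[leRHS]mul1r ler_pdivlMr ?subr_gt0//.
have gE : g = 1 + g * b by rewrite -{1}gb mulrBr mulr1 subrK.
have : opnorm g <= 1 + opnorm g * q.
  rewrite {1}gE (le_trans (opnormD_le _ _))// lerD// ?opnorm1_le//.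
  by rewrite (le_trans (opnormM _ _))// ler_wpM2l ?opnorm_ge0.
by rewrite mulrBr mulr1 lerBlDr.
Qed.

(** The geometric sum [s] is a cofactor of [1 - b] in [1 - b ^+ n] on both sides, so [s * g] is a
    right and [g * s] a left inverse. *)
Lemma neumann_pow b n : opnorm (b ^+ n) < 1 -> exists g, is_inverse (1 - b) g.
Proof.
move=> /neumann[g [bg gb]]; pose s := \sum_(i < n) b ^+ i.
exists (s * g); apply: (@is_inverse_lr _ _ _ _ (g * s)).
  by rewrite mulrA geometric_telescope.
by rewrite -mulrA geometric_telescopeC.
Qed.

(** Since [h - k = h * (1 - g * k)], a Neumann series gives the inverse; the distance estimate is
    the resolvent identity [g' - g = g' * k * g]. *)
Lemma inverse_perturb h k g :
    is_inverse h g -> opnorm g * opnorm k <= 2^-1 ->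
  exists g', [/\ is_inverse (h - k) g', opnorm g' <= 2 * opnorm g &
     opnorm (g' - g) <= 2 * opnorm g ^+ 2 * opnorm k].
Proof.
move=> [hg gh] gk.
have gk1 : opnorm (g * k) <= 2^-1 := le_trans (opnormM _ _) gk.
have half : 2^-1 < 1 :> R by rewrite invf_lt1// ltr1n.
have [d dP] := neumann (le_lt_trans gk1 half).
have d2 : opnorm d <= 2.
  have := neumann_bound gk1 half dP; suff -> : (1 - 2^-1)^-1 = 2 :> R by [].
  by field.
have hkE : h * (1 - g * k) = h - k by rewrite mulrBr mulr1 mulrA hg mul1r.
have g'P : is_inverse (h - k) (d * g) by rewrite -hkE; exact: is_inverseM.
have g'2 : opnorm (d * g) <= 2 * opnorm g.
  by rewrite (le_trans (opnormM _ _))// ler_wpM2r ?opnorm_ge0.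
exists (d * g); split=> //.
have -> : d * g - g = (d * g) * k * g.
  have : d * g * (h * g) - d * g * (h - k) * g = d * g * k * g.
    by rewrite mulrA -mulrBl -mulrBr opprB addrCA subrr addr0.
  by rewrite hg mulr1 g'P.2 mul1r.
rewrite (le_trans (opnormM _ _))// (le_trans (ler_wpM2r (opnorm_ge0 _) (opnormM _ _)))//.
rewrite mulrAC expr2 mulrA ler_wpM2r ?opnorm_ge0// ler_wpM2r ?opnorm_ge0//.
Qed.

End Neumann.

(** * Gelfand's formula *)

Lemma exists_root (R : realType) (x : R) n : 0 <= x -> (0 < n)%N ->
  exists2 t, 0 <= t & t ^+ n = x.
Proof.
move=> x0 n0; exists (x `^ n%:R^-1); first exact: powR_ge0.
by rewrite -powR_mulrn ?powR_ge0// -powRrM mulVf ?powRr1// pnatr_eq0 -lt0n.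
Qed.

Section SpectralRadius.
Context {R : realType} {E : normedModType R[i]} (a : bop E E).

(** The infimum of these [t] is the limit of the n-th roots of [opnorm (a ^+ n)]. *)
Definition exp_bounded (t : R) : Prop :=
  0 < t /\ exists C, forall n, opnorm (a ^+ n) <= C * t ^+ n.

Lemma exp_bounded_le (s t : R) : s <= t -> exp_bounded s -> exp_bounded t.
Proof.
move=> st [s0 [C aC]]; have t0 := lt_le_trans s0 st; split=> //.
exists C => n; rewrite (le_trans (aC n))// ler_wpM2l//.
  by have := le_trans (opnorm_ge0 _) (aC 0%N); rewrite expr0 mulr1.
by rewrite lerXn2r// nnegrE ltW.
Qed.

Lemma exp_bounded_of_pow (t : R) N : 0 < t -> (0 < N)%N ->
  opnorm (a ^+ N) <= t ^+ N -> exp_bounded t.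
Proof.
move=> t0 N0 aN; split=> //.
(* Division of n by [N] leaves a remainder j below [N]; the sum serves all remainders at once. *)
exists (\sum_(j < N) opnorm (a ^+ j) * t ^- j) => n.
have jN : (n %% N < N)%N by rewrite ltn_mod.
rewrite {1}(divn_eq n N) exprD mulnC exprM (le_trans (opnormM _ _))//.
have aq : opnorm ((a ^+ N) ^+ (n %/ N)) <= t ^+ (n - n %% N).
  have -> : (n - n %% N = N * (n %/ N))%N by rewrite {1}(divn_eq n N) addnK mulnC.
  by rewrite (le_trans (opnormX _ _))// exprM lerXn2r ?nnegrE ?opnorm_ge0 ?exprn_ge0// ltW.
rewrite (le_trans (ler_wpM2r (opnorm_ge0 _) aq))//.
rewrite -[in leRHS](subnK (leq_mod n N)) exprD mulrCA ler_wpM2l ?exprn_ge0 ?(ltW t0)//.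
rewrite -ler_pdivrMr ?exprn_gt0// (bigD1 (Ordinal jN))//= lerDl sumr_ge0// => i _.
by rewrite divr_ge0 ?opnorm_ge0// exprn_ge0// ltW.
Qed.

Lemma exp_bounded_large : exp_bounded (opnorm a + 1).
Proof.
have a0 := opnorm_ge0 a; split; first by rewrite ltr_wpDl.
exists 1 => n; rewrite mul1r (le_trans (opnormX _ _))// lerXn2r// ?nnegrE//.
  by rewrite addr_ge0.
by rewrite lerDl.
Qed.

Lemma spectral_radius_ge0 : 0 <= spectral_radius a.
Proof.
(* [sup] takes the value 0 on a set that is empty or unbounded above. *)
have [[[_ [z za _]] hub]|noSup] :=
  pselect (has_sup [set complex.Re `|z| | z in spectrum a]); last first.
  by rewrite /spectral_radius sup_out.
apply: le_trans (cabs_ge0 z) _; apply: ub_le_sup hub _ _; by exists z.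
Qed.

Hypothesis E_complete : geom_complete E.

(** Otherwise the n-th power of [z^-1 *: a] has norm below 1, and [neumann_pow] inverts
    [z *: bop_id - a]. *)
Lemma spectrum_pow_le z n : spectrum a z -> (0 < n)%N ->
  cabs z ^+ n <= opnorm (a ^+ n).
Proof.
move=> za n0; rewrite leNgt; apply/negP => az; apply: za.
have z0 : z != 0.
  apply: contraTneq az => ->; rewrite cabs0 expr0n gtn_eqF//.
  by rewrite -leNgt opnorm_ge0.
have cz : 0 < cabs z by rewrite lt_def cabs_eq0 z0 cabs_ge0.
have [|g gP] := @neumann_pow _ _ E_complete (z^-1 *: a) n.
  rewrite bop_scaleX opnormZE cabsX cabsV exprVn mulrC ltr_pdivrMr ?exprn_gt0//.
  by rewrite mul1r.
have := is_inverseZ z0 gP.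
by rewrite scalerBr scalerA divff// scale1r => /is_inverse_invertible.
Qed.

Lemma cabs_spectrum_le z : spectrum a z -> cabs z <= spectral_radius a.
Proof.
move=> za; apply: (ub_le_sup _); last by exists z.
exists (opnorm a) => _ [w wa <-].
by have := spectrum_pow_le wa (ltn0Sn 0); rewrite !expr1.
Qed.

Lemma spectral_radius_pow_le n : (0 < n)%N ->
  spectral_radius a ^+ n <= opnorm (a ^+ n).
Proof.
move=> n0; have [t t0 tn] := exists_root (opnorm_ge0 (a ^+ n)) n0.
rewrite -tn lerXn2r// ?nnegrE ?spectral_radius_ge0//.
have [[ne _]|noSup] :=
  pselect (has_sup [set complex.Re `|z| | z in spectrum a]); last first.
  by rewrite /spectral_radius sup_out.
apply: ge_sup ne _ => _ [z za <-].
rewrite -(@ler_pXn2r _ n)// ?nnegrE ?cabs_ge0// tn.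
exact: spectrum_pow_le.
Qed.

Lemma resolvent_outside z : spectral_radius a < cabs z ->
  exists g, is_inverse (1 - z^-1 *: a) g.
Proof.
move=> az; have z0 : z != 0.
  by rewrite -cabs_eq0 gt_eqF// (le_lt_trans _ az)// spectral_radius_ge0.
have : bop_invertible (z *: bop_id - a).
  by apply: contrapT => /cabs_spectrum_le; rewrite leNgt az.
move=> /bop_invertibleP[g /(is_inverseZ (invr_neq0 z0)) gP].
exists (z^-1^-1 *: g); move: gP.
by rewrite scalerBr scalerA mulVf// scale1r.
Qed.

End SpectralRadius.

(** * Uniform resolvent bounds on the unit circle *)

Section CircleBound.
Context {R : realType} {E : normedModType R[i]} (b : bop E E).
Hypothesis E_complete : geom_complete E.

Definition resolvent_le (M : R) (u : R[i]) : Prop :=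
  exists2 g, is_inverse (1 - u *: b) g & opnorm g <= M.

Lemma resolvent_le_near u g : is_inverse (1 - u *: b) g ->
  exists2 d : R, 0 < d & forall v, cabs (v - u) <= d ->
    resolvent_le (2 * opnorm g) v.
Proof.
move=> ug; have gb0 : 0 < 2 * (opnorm g * opnorm b + 1).
  by rewrite mulr_gt0// ltr_wpDl// mulr_ge0 ?opnorm_ge0.
(* This radius keeps the norm of g times that of [(v - u) *: b] at most 1/2; the summand 1 keeps the
   denominator positive. *)
exists (2 * (opnorm g * opnorm b + 1))^-1; first by rewrite invr_gt0.
move=> v vu; have [|g' [g'P g'2 _]] := inverse_perturb E_complete (k := (v - u) *: b) ug.
  rewrite opnormZE mulrCA (le_trans (ler_wpM2r _ vu)) ?mulr_ge0 ?opnorm_ge0//.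
  rewrite invfM -mulrA ler_piMr ?invr_ge0// mulrC ler_pdivrMr ?mul1r ?lerDl//.
  by rewrite ltr_wpDl// mulr_ge0 ?opnorm_ge0.
by exists g' => //; move: g'P; rewrite scalerBl opprB addrA subrK.
Qed.

Lemma resolvent_bounded_arc (w : R -> R[i]) :
    (forall x d, 0 < d -> \forall y \near x, cabs (w y - w x) <= d) ->
    (forall x, x \in `[-1, 1] -> exists g, is_inverse (1 - w x *: b) g) ->
  exists M, forall x, x \in `[-1, 1] -> resolvent_le M (w x).
Proof.
move=> wc wb.
(* Compactness in near-covering form: the local bounds [2 * opnorm g] are absorbed by one M tending
   to infinity. *)
have /compact_near_coveringP cover := @segment_compact R (-1) 1.
case: (cover R (pinfty_nbhs R) (fun M x => resolvent_le M (w x)) _).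
  move=> x /= xI; have [g xg] := wb x xI.
  have [d d0 dP] := resolvent_le_near xg.
  exists ([set y | cabs (w y - w x) <= d], [set M | 2 * opnorm g <= M]).
    by split; [exact: wc|apply: nbhs_pinfty_ge; exact: num_real].
  move=> [y M]/= [/dP[g' yg g'M] gM]; exists g' => //; exact: le_trans gM.
move=> M [_ HM]; exists (M + 1) => x xI.
by apply: (HM (M + 1)) => //; rewrite ltrDl.
Qed.

End CircleBound.

(* Halves of the unit circle as graphs over the compact segment [-1, 1]. *)
Lemma resolvent_bounded_circle (R : realType) (E : normedModType R[i])
    (b : bop E E) : geom_complete E ->
  (forall u, cabs u = 1 -> exists g, is_inverse (1 - u *: b) g) ->
  exists2 M, 0 < M & forall u, cabs u = 1 -> resolvent_le b M u.
Proof.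
move=> E_complete bu.
have cabs2 (z : R[i]) : cabs z ^+ 2 = complex.Re z ^+ 2 + complex.Im z ^+ 2.
  by apply: (@complexI R); rewrite rmorphXn/= cabsE -add_Re2_Im2.
(* The sign [e] selects the upper or the lower half of the circle. *)
have half (e : R) : `|e| = 1 -> exists M, forall x, x \in `[-1, 1] ->
    resolvent_le b M (x +i* (e * Num.sqrt (1 - x ^+ 2))).
  move=> e1; apply: resolvent_bounded_arc => //.
    move=> x d d0.
    have sqc : (fun y : R => Num.sqrt (1 - y ^+ 2)) @ x --> Num.sqrt (1 - x ^+ 2).
      apply: (@continuous_comp _ _ _ (fun y : R => 1 - y ^+ 2) Num.sqrt).
        by apply: cvgB; [exact: cvg_cst|exact: exprn_continuous].
      exact: sqrt_continuous.
    have d2 : 0 < d / 2 by rewrite divr_gt0.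
    have /cvgrPdistC_le/(_ _ d2) near1 := sqc.
    have /cvgrPdistC_le/(_ _ d2) near2 : y @[y --> x] --> x by exact: cvg_id.
    apply: filterS2 near1 near2 => y sy yx.
    apply: le_trans (cabs_le_ReIm _) _ => /=.
    by rewrite -mulrBr normrM e1 mul1r [leRHS]splitr lerD.
  move=> x; rewrite in_itv/= => /andP[x1 x2]; apply: bu.
  apply/eqP; rewrite -(@eqrXn2 _ 2) ?cabs_ge0 ?ler01// cabs2 expr1n/= exprMn.
  rewrite -(real_normK (num_real e)) e1 expr1n mul1r sqr_sqrtr; last nra.
  by rewrite addrC subrK.
have [M1 P1] := half 1 (normr1 _).
have [M2 P2] := half (-1) (normrN1 _).
exists (Num.max 1 (Num.max M1 M2)); first by rewrite lt_max ltr01.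
move=> u u1; have := cabs2 u; rewrite u1 expr1n => /esym ReIm.
have uI : complex.Re u \in `[-1, 1].
  by rewrite in_itv/= -ler_norml -u1 Re_le_cabs.
have sq : Num.sqrt (1 - complex.Re u ^+ 2) = `|complex.Im u|.
  by rewrite -ReIm addrC addKr sqrtr_sqr.
have [I0|I0] := leP 0 (complex.Im u).
  have [g ug gM] := P1 _ uI; exists g; last by rewrite !le_max gM orbT.
  by move: ug; rewrite sq mul1r ger0_norm//; case: (u).
have [g ug gM] := P2 _ uI; exists g; last by rewrite !le_max gM !orbT.
by move: ug; rewrite sq mulN1r ltr0_norm// opprK; case: (u).
Qed.

(** * Averaging resolvents over roots of unity *)

Section Rickart.
Context {R : realType} {E : normedModType R[i]}.
Implicit Types b c g x : bop E E.

(** Multiplying u by such a z changes the sign of [u ^+ (2 ^ m)], which supplies the inverse of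
    [1 + x] for [is_inverse_mean]. *)
Lemma exists_unit_sqrt_root m :
  exists2 z : R[i], cabs z = 1 & z ^+ (2 ^ m) = -1.
Proof.
elim: m => [|m [z z1 zm]].
  by exists (-1); rewrite ?expr1// /cabs normrN normr1.
have zz := sqr_sqrtc z; exists (sqrtc z); last by rewrite expnS exprM zz.
by apply/eqP; rewrite -(@eqrXn2 _ 2) ?cabs_ge0 ?ler01// -cabsX zz z1 expr1n.
Qed.

(** As [1 - x ^+ 2 = (1 - x) * (1 + x)], multiplying it by g leaves [1 + x] and by g' leaves
    [1 - x]; these add up to 2. *)
Lemma is_inverse_mean x g g' : is_inverse (1 - x) g -> is_inverse (1 + x) g' ->
  is_inverse (1 - x ^+ 2) (2^-1 *: (g + g')).
Proof.
move=> [xg gx] [xg' gx'].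
have xE : 1 - x ^+ 2 = (1 + x) * (1 - x).
  by rewrite mulrDl mul1r mulrBr mulr1 addrA subrK expr2.
have xE' : 1 - x ^+ 2 = (1 - x) * (1 + x).
  by rewrite mulrBl mul1r mulrDr mulr1 opprD addrA addrK expr2.
have two : 2^-1 *: ((1 + x) + (1 - x)) = 1.
  rewrite addrACA subrr addr0 -mulr2n -(scaler_nat 2 (1 : bop E E)) scalerA mulVf ?scale1r//.
split.
  by rewrite -bop_scaleAr mulrDr {1}xE xE' -!mulrA xg xg' !mulr1 two.
by rewrite -bop_scaleAl mulrDl {1}xE' xE !mulrA gx gx' !mul1r two.
Qed.

(* The mean over the 2^m-th roots of unity of the resolvents of b is the
   resolvent of b^(2^m), so a uniform estimate on the circle passes to powers. *)
Lemma resolvent_power_dist b c (eps : R) :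
    (forall u : R[i], cabs u = 1 -> exists g g', [/\ is_inverse (1 - u *: b) g,
       is_inverse (1 - u *: c) g' & opnorm (g - g') <= eps]) ->
  forall m (u : R[i]), cabs u = 1 -> exists g g',
    [/\ is_inverse (1 - (u *: b) ^+ (2 ^ m)) g,
        is_inverse (1 - (u *: c) ^+ (2 ^ m)) g' & opnorm (g - g') <= eps].
Proof.
move=> bc; elim=> [|m IH] u u1; first by rewrite expn0 !expr1; exact: bc.
have [z z1 zm] := exists_unit_sqrt_root m.
have [g [g' [ug ug' gg']]] := IH u u1.
have zu1 : cabs (z * u) = 1 by rewrite cabsM z1 u1 mulr1.
have [h [h' [uh uh' hh']]] := IH _ zu1.
have zuE (d : bop E E) : 1 - ((z * u) *: d) ^+ (2 ^ m) = 1 + (u *: d) ^+ (2 ^ m).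
  by rewrite -scalerA bop_scaleX zm scaleN1r opprK.
rewrite zuE in uh; rewrite zuE in uh'.
exists (2^-1 *: (g + h)), (2^-1 *: (g' + h')); split.
- by rewrite expnSr exprM; exact: is_inverse_mean.
- by rewrite expnSr exprM; exact: is_inverse_mean.
rewrite -scalerBr opprD addrACA opnormZE cabsV -[2]/(2%:R) -(natr1) .
have -> : cabs (1%:R + 1 : R[i]) = 2.
  by rewrite natr1 -[_%:R](rmorph_nat (real_complex R)) cabsC ger0_norm.
by rewrite ler_pdivrMl// mulr_natl mulr2n (le_trans (opnormD_le _ _))// lerD.
Qed.

Hypothesis E_complete : geom_complete E.

(** Here g is within 1/12 of 1, so g' is within 1/4 + 1/12 = 1/3 of 1. Then
    [- y = (1 - y) * (1 - g')] gives [opnorm y <= (1 + opnorm y) / 3]. *)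
Lemma pow_small_of_resolvent x g g' y : is_inverse (1 - x) g -> is_inverse (1 - y) g' ->
  opnorm x <= 13^-1 :> R -> opnorm (g - g') <= 4^-1 -> opnorm y <= 2^-1.
Proof.
move=> xg yg' x13 gg'.
have q1 : 13^-1 < 1 :> R by rewrite invf_lt1// ltr1n.
have g13 := neumann_bound x13 q1 xg.
have g1 : opnorm (g - 1) <= 12^-1.
  have -> : g - 1 = g * x by rewrite -{1}xg.2 mulrBr mulr1 opprB addrC subrK.
  rewrite (le_trans (opnormM _ _))// (le_trans (ler_pM _ _ g13 x13)) ?opnorm_ge0//.
  by rewrite le_eqVlt; apply/orP; left; apply/eqP; field.
have g'1 : opnorm (1 - g') <= 3^-1.
  rewrite -opnormN opprB -(subrKA g) (le_trans (opnormD_le _ _))//.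
  rewrite -opnormN opprB (le_trans (lerD gg' g1))//.
  by rewrite le_eqVlt; apply/orP; left; apply/eqP; field.
have yE : - y = (1 - y) * (1 - g').
  by rewrite mulrBr mulr1 yg'.1 addrAC subrr add0r.
have : opnorm y <= (1 + opnorm y) * 3^-1.
  rewrite -{1}opnormN yE (le_trans (opnormM _ _))// ler_pM ?opnorm_ge0//.
  by rewrite (le_trans (opnormD_le _ _))// opnormN lerD// opnorm1_le.
lra.
Qed.

End Rickart.

Lemma expr_small (R : realType) (C q eps : R) : 0 <= q -> q < 1 -> 0 < eps ->
  exists N, forall n, (N <= n)%N -> C * q ^+ n <= eps.
Proof.
move=> q0 q1 eps0.
have : (fun n => C * q ^+ n) @ \oo --> (0 : R).
  by rewrite -[X in _ --> X](mulr0 C); apply: cvgMr; apply: cvg_expr; rewrite ger0_norm.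
by move=> /cvgr_le/(_ _ eps0)[N _ HN]; exists N => n; exact: HN.
Qed.

(* The hard half of Gelfand's formula, by Rickart's argument: if the
   resolvent existed on the circle whose radius is the exponential growth rate
   rho > 0, then the resolvents of the powers of a / rho would stay close to
   those of a / t for t > rho near rho, which tend to 1; hence some power of
   a / rho would have norm below 1. *)
Lemma spectral_radius_exp_bounded (R : realType) (E : normedModType R[i])
    (a : bop E E) (s : R) : geom_complete E ->
  spectral_radius a < s -> exp_bounded a s.
Proof.
move=> E_complete as_.
pose rho := inf [set t | exp_bounded a t].
have lb0 : lbound [set t | exp_bounded a t] 0 by move=> t [t0 _]; exact: ltW.
have hinf : has_inf [set t | exp_bounded a t].
  by split; [exists (opnorm a + 1); exact: exp_bounded_large|exists 0].
have above t : rho < t -> exists2 t0, exp_bounded a t0 & t0 < t.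
  rewrite -subr_gt0 => /inf_adherent/(_ hinf)[t0 at0].
  by rewrite addrC subrK => t0t; exists t0.
have [rho_s|s_rho] := ltP rho s.
  have [t at_ ts] := above s rho_s; exact: exp_bounded_le (ltW ts) at_.
(* In the remaining case the spectral radius lies below [rho], and this has to be contradicted. *)
have r_rho := lt_le_trans as_ s_rho.
have rho0 : 0 < rho := le_lt_trans (spectral_radius_ge0 a) r_rho.
pose b := (rho^-1)%:C *: a.
have bu u : cabs u = 1 -> exists g, is_inverse (1 - u *: b) g.
  move=> u1; have [|g gP] := @resolvent_outside _ _ a E_complete (rho%:C / u).
    by rewrite cabsM cabsV u1 invr1 mulr1 cabsC ger0_norm// ltW.
  by exists g; move: gP; rewrite invfM invrK mulrC /b scalerA fmorphV.
have [M M0 HM] := resolvent_bounded_circle E_complete bu.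
pose K := opnorm b + 1.
have K0 : 0 < K by rewrite ltr_wpDl ?opnorm_ge0.
have M1 : 0 < M + 1 by rewrite ltr_wpDl// ltW.
(* With this [eta] the operator [d] below has norm at most 1/(8 (M+1)^2), so the resolvents on the
   circle move by at most 2 (M+1)^2 times that, which is 1/4. *)
pose eta := (8 * (M + 1) ^+ 2 * K)^-1.
have eta0 : 0 < eta by rewrite invr_gt0 mulr_gt0// mulr_gt0// exprn_gt0.
pose t := rho * (1 + eta).
have rt : rho < t by rewrite /t mulrDr mulr1 ltrDl mulr_gt0.
have t_gt0 : 0 < t := lt_trans rho0 rt.
(* As [t0 < t], the powers of a scaled by [t^-1] tend to 0 in norm. *)
have [t0 [t0_gt0 [C aC]] t0t] := above t rt.
pose c := (t^-1)%:C *: a.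
pose d := (eta / (1 + eta))%:C *: b.
have eta1 : 0 < 1 + eta by rewrite ltr_wpDl.
have cE : c = b - d.
  rewrite -[b in b - _]scale1r -scalerBl /c /b scalerA; congr (_ *: _).
  rewrite -[1]/((1 : R)%:C) -rmorphB -rmorphM/=; congr _%:C.
  by rewrite /t; field; rewrite !gt_eqF.
have dK : opnorm d <= eta * K.
  have eta'0 : 0 <= eta / (1 + eta) by rewrite divr_ge0// ltW.
  rewrite opnormZE cabsC ger0_norm// ler_pM ?opnorm_ge0//.
    by rewrite ler_pdivrMr// ler_pMr// lerDl ltW.
  by rewrite /K lerDl.
have etaK : eta * K = (8 * (M + 1) ^+ 2)^-1.
  by rewrite /eta; field; rewrite !gt_eqF.
rewrite {}etaK in dK.
have near1 u : cabs u = 1 -> exists g g', [/\ is_inverse (1 - u *: c) g,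
    is_inverse (1 - u *: b) g' & opnorm (g - g') <= 4^-1].
  move=> u1; have [g ug gM] := HM u u1.
  have ud : opnorm (- (u *: d)) <= (8 * (M + 1) ^+ 2)^-1.
    by rewrite opnormN opnormZE u1 mul1r.
  have gM1 : opnorm g <= M + 1 by rewrite (le_trans gM)// lerDl.
  have [|g' [ug' _ gg']] := inverse_perturb E_complete (k := - (u *: d)) ug.
    rewrite (le_trans (ler_pM _ _ gM1 ud)) ?opnorm_ge0//.
    rewrite ler_pdivrMr ?mulr_gt0 ?exprn_gt0//; nra.
  exists g', g; split=> //.
    by rewrite cE scalerBr opprD addrA.
  rewrite (le_trans gg')// (@le_trans _ _ (2 * (M + 1) ^+ 2 * (8 * (M + 1) ^+ 2)^-1))//.
    apply: ler_pM; rewrite ?mulr_ge0 ?sqr_ge0 ?opnorm_ge0//.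
    by rewrite ler_wpM2l// lerXn2r// nnegrE ?opnorm_ge0// ltW.
  rewrite le_eqVlt; apply/orP; left; apply/eqP; field; by rewrite gt_eqF.
have q0 : 0 <= t0 / t by rewrite divr_ge0// ltW.
have q1 : t0 / t < 1 by rewrite ltr_pdivrMr// mul1r.
have i13 : 0 < 13^-1 :> R by rewrite invr_gt0.
have [m Hm] := expr_small C q0 q1 i13.
have m2 : (m <= 2 ^ m)%N by rewrite ltnW// ltn_expl.
have cm : opnorm (c ^+ (2 ^ m)) <= 13^-1.
  rewrite bop_scaleX opnormZE cabsX cabsC ger0_norm ?invr_ge0 ?(ltW t_gt0)//.
  apply: le_trans (Hm _ m2); rewrite expr_div_n mulrA mulrC exprVn.
  by rewrite ler_pM2r ?invr_gt0 ?exprn_gt0// aC.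
have [g [g' [cg bg' gg']]] := resolvent_power_dist near1 m (cabs1 : cabs (1 : R[i]) = 1).
rewrite !scale1r in cg bg'.
have := pow_small_of_resolvent cg bg' cm gg'.
rewrite bop_scaleX opnormZE cabsX cabsC ger0_norm ?invr_ge0 ?(ltW rho0)//.
rewrite exprVn mulrC ler_pdivrMr ?exprn_gt0// => small.
have N0 : (0 < 2 ^ m)%N by rewrite expn_gt0.
have small0 : 0 < 2^-1 * rho ^+ (2 ^ m) by rewrite mulr_gt0 ?invr_gt0 ?exprn_gt0.
(* The norm of [a ^+ (2 ^ m)] is at most half of [rho ^+ (2 ^ m)], so this root is an admissible
   rate below the infimum [rho]. *)
have [t' t'0 t'E] := exists_root (ltW small0) N0.
have t'_gt0 : 0 < t'.
  rewrite lt_def t'0 andbT; apply: contraTneq small0 => t'z.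
  by rewrite -t'E t'z expr0n gtn_eqF// ltxx.
have : exp_bounded a t' by apply: (exp_bounded_of_pow t'_gt0 N0); rewrite t'E.
move=> at'; have : rho <= t' by apply: ge_inf; [exists 0|].
rewrite leNgt -(@ltr_pXn2r _ (2 ^ m)) ?nnegrE ?(ltW rho0)// t'E.
by rewrite gtr_pMl ?exprn_gt0// invf_lt1// ltr1n.
Qed.

(** * The Hahn-Banach theorem *)

Section HahnBanach.
Context {R : realType} {E : lmodType R[i]}.
Implicit Types (p q f : E -> R) (x y : E).

(** Homogeneity is only an inequality for positive [t], the form that passes to infima; [sublinearZ]
    recovers equality. *)
Definition sublinear p : Prop :=
  (forall x y, p (x + y) <= p x + p y) /\
  (forall (t : R) x, 0 < t -> p (t%:C *: x) <= t * p x).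

Lemma sublinear0 p : sublinear p -> p 0 = 0.
Proof.
move=> [pD pZ]; have := pD 0 0; have := pZ (2^-1) 0.
rewrite addr0 scaler0 invr_gt0 ltr0n => /(_ isT) p0 p00.
by apply/eqP; rewrite eq_le; apply/andP; split; lra.
Qed.

Lemma sublinear_ge p x : sublinear p -> - p (- x) <= p x.
Proof.
by move=> sp; have := sp.1 x (- x); rewrite subrr sublinear0//; lra.
Qed.

Lemma sublinearZ p (t : R) x : sublinear p -> 0 <= t -> p (t%:C *: x) = t * p x.
Proof.
move=> sp; rewrite le_eqVlt => /predU1P[<-|t0].
  by rewrite mul0r scale0r sublinear0.
apply/eqP; rewrite eq_le sp.2//= -ler_pdivlMl//.
have t0' : 0 < t^-1 by rewrite invr_gt0.
have := sp.2 _ (t%:C *: x) t0'.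
by rewrite scalerA -rmorphM mulVf ?gt_eqF// scale1r.
Qed.

(** For sublinear [p], the largest sublinear functional below [p] whose value at [- y] is at most
    [- p y]. *)
Definition sublinear_along p y x : R :=
  inf [set p (x + t%:C *: y) - t * p y | t in [set t | 0 <= t]].

Lemma sublinear_along_le p y x (t : R) : sublinear p -> 0 <= t ->
  sublinear_along p y x <= p (x + t%:C *: y) - t * p y.
Proof.
move=> sp t0; apply: ge_inf; last by exists t.
exists (- p (- x)) => _ [s /= s0 <-].
rewrite -(sublinearZ _ sp s0) lerBrDr addrC lerBlDr.
by have := sp.1 (x + s%:C *: y) (- x); rewrite addrAC subrr add0r.
Qed.

Lemma sublinear_along_ge p y x (c : R) :
  (forall t : R, 0 <= t -> c <= p (x + t%:C *: y) - t * p y) ->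
  c <= sublinear_along p y x.
Proof.
move=> cp; apply: lb_le_inf; last by move=> _ [t t0 <-]; exact: cp.
by exists (p (x + (0 : R)%:C *: y) - 0 * p y), 0 => /=.
Qed.

Lemma sublinear_along_le0 p y x : sublinear p -> sublinear_along p y x <= p x.
Proof.
move=> sp; have := sublinear_along_le y x sp (lexx 0).
by rewrite scale0r addr0 mul0r subr0.
Qed.

Lemma sublinear_along_sublinear p y :
  sublinear p -> sublinear (sublinear_along p y).
Proof.
move=> sp; split=> [x1 x2|t x t0].
  rewrite -lerBlDr; apply: sublinear_along_ge => t1 t10.
  rewrite lerBlDr -lerBlDl; apply: sublinear_along_ge => t2 t20.
  have t12 : 0 <= t1 + t2 by rewrite addr_ge0.
  have := sublinear_along_le y (x1 + x2) sp t12.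
  have := sp.1 (x1 + t1%:C *: y) (x2 + t2%:C *: y).
  by rewrite rmorphD scalerDl addrACA; lra.
rewrite -ler_pdivrMl//; apply: sublinear_along_ge => s s0.
rewrite ler_pdivrMl//.
have ts0 : 0 <= t * s by rewrite mulr_ge0// ltW.
apply: le_trans (sublinear_along_le y _ sp ts0) _.
rewrite rmorphM -scalerA -scalerDr mulrBr -mulrA lerB//.
by rewrite sublinearZ// ltW.
Qed.

(** Zorn's lemma for the reversed pointwise order: a chain is bounded by its pointwise infimum,
    finite because [- p (- x)] bounds every member below. *)
Lemma minimal_sublinear p : sublinear p -> exists f,
  [/\ sublinear f, forall x, f x <= p x &
      forall q, sublinear q -> (forall x, q x <= f x) -> q = f].
Proof.
move=> sp; pose T := {q : E -> R | sublinear q /\ forall x, q x <= p x}.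
pose le_T (q q' : T) := `[< forall x, sval q' x <= sval q x >].
have [||||f fmin] := @Zorn T le_T.
- by move=> q; apply/asboolP.
- move=> q1 q2 q3 /asboolP q12 /asboolP q23; apply/asboolP => x.
  exact: le_trans (q12 x).
- move=> [q1 h1] [q2 h2] /asboolP/= q12 /asboolP/= q21; apply: eq_exist => /=.
  by apply/funext => x; apply/eqP; rewrite eq_le q12 q21.
- move=> A Atot.
  (* The empty chain is bounded by [p] itself. *)
  have [[q0 Aq0]|A0] := pselect (exists q : T, A q); last first.
    by exists (exist _ p (conj sp (fun=> lexx _))) => s As; case: A0; exists s.
  pose m x := inf [set sval (q : T) x | q in A].
  have m_le (q : T) x : A q -> m x <= sval q x.
    move=> Aq; apply: ge_inf; last by exists q.
    exists (- p (- x)) => _ [q' Aq' <-]; have [sq' q'p] := svalP q'.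
    by rewrite (le_trans _ (sublinear_ge x sq'))// lerN2.
  have m_ge c x : (forall q : T, A q -> c <= sval q x) -> c <= m x.
    move=> cq; apply: lb_le_inf; first by exists (sval q0 x), q0.
    by move=> _ [q Aq <-]; exact: cq.
  have sm : sublinear m.
    split=> [x y|t x t0].
      rewrite -lerBlDr; apply: (m_ge) => q Aq.
      rewrite lerBlDr -lerBlDl; apply: (m_ge) => q' Aq'.
      rewrite lerBlDl.
      (* The chain is total, so the smaller of the two functionals can be used at both x and y. *)
      have [/asboolP qq'|/asboolP q'q] := Atot q q' Aq Aq'.
        rewrite (le_trans (m_le _ _ Aq'))// (le_trans ((svalP q').1.1 _ _))//.
        by rewrite lerD2r.
      rewrite (le_trans (m_le _ _ Aq))// (le_trans ((svalP q).1.1 _ _))//.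
      by rewrite lerD2l.
    rewrite -ler_pdivrMl//; apply: (m_ge) => q Aq; rewrite ler_pdivrMl//.
    by rewrite (le_trans (m_le _ _ Aq))//; exact: (svalP q).1.2.
  have mp x : m x <= p x by rewrite (le_trans (m_le q0 _ _))//; exact: (svalP q0).2.
  by exists (exist _ m (conj sm mp)) => q Aq; apply/asboolP => x; exact: m_le.
exists (sval f); split; [exact: (svalP f).1|exact: (svalP f).2|].
move=> q sq qf.
have qp x : q x <= p x by rewrite (le_trans (qf x))//; exact: (svalP f).2.
have := fmin (exist _ q (conj sq qp)); move=> /(_ (asboolT qf)) <- //.
Qed.

Definition real_linear f : Prop :=
  (forall x y, f (x + y) = f x + f y) /\
  (forall (t : R) x, f (t%:C *: x) = t * f x).

(** Minimality forces [sublinear_along f y = f], and t = 1 in its infimum gives superadditivity. *)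
Lemma minimal_sublinear_linear f : sublinear f ->
  (forall q, sublinear q -> (forall x, q x <= f x) -> q = f) -> real_linear f.
Proof.
move=> sf fmin.
have fD x y : f (x + y) = f x + f y.
  apply/eqP; rewrite eq_le sf.1/= -lerBrDr.
  have {1}<- : sublinear_along f y = f.
    apply: fmin; first exact: sublinear_along_sublinear.
    by move=> z; exact: sublinear_along_le0.
  by have := sublinear_along_le y x sf ler01; rewrite scale1r mul1r.
have fN x : f (- x) = - f x.
  by apply/eqP; rewrite -addr_eq0 -fD addNr sublinear0.
split=> // t x; have [t0|t0] := leP 0 t; first exact: sublinearZ.
rewrite -[t]opprK rmorphN scaleNr fN sublinearZ ?mulNr//.
by rewrite oppr_ge0 ltW.
Qed.

(** A complex linear v satisfies Im v(x) = - Re v(ix), so its real part dictates this formula. *)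
Lemma complexify_linear f : real_linear f ->
  linear (fun x => f x +i* (- f ('i%C *: x)) : R[i]^o).
Proof.
move=> [fD fZ].
have fi y : f ('i%C *: ('i%C *: y)) = - f y.
  rewrite scalerA -expr2 sqr_i -[-1](rmorphN1 (real_complex R)).
  by rewrite fZ mulN1r.
have fc (k : R[i]) y :
    f (k *: y) = complex.Re k * f y + complex.Im k * f ('i%C *: y).
  by rewrite [in LHS](complexE k) scalerDl fD fZ (mulrC 'i%C) -scalerA fZ.
move=> k x y; rewrite fD scalerDr fD (fc k).
have -> : 'i%C *: (k *: x) = k *: ('i%C *: x) by rewrite !scalerA mulrC.
rewrite (fc k) fi; case: k => u v.
by apply/eqP; rewrite eq_complex/=; apply/andP; split; apply/eqP; ring.
Qed.

End HahnBanach.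

Lemma hahn_banach_norming (R : realType) (E : normedModType R[i]) (x : E) :
  exists2 v : dual_space E, opnorm v <= 1 & rnorm x <= cabs (v x).
Proof.
have sn : sublinear (@rnorm R E).
  split=> [y z|t y t0]; first exact: ler_rnormD.
  by rewrite rnormZE cabsC ger0_norm// ltW.
(* Starting below [sublinear_along] of the norm, and not just below the norm, forces
   [f (- x) <= - rnorm x], so that [f] norms x. *)
have [f [sf fp fmin]] := minimal_sublinear (sublinear_along_sublinear x sn).
have [fD fZ] := minimal_sublinear_linear sf fmin.
have fn y : f y <= rnorm y := le_trans (fp y) (sublinear_along_le0 x y sn).
have fx : rnorm x <= f x.
  have : f (- x) <= - rnorm x.
    apply: le_trans (fp _) _; have := sublinear_along_le x (- x) sn ler01.
    by rewrite scale1r mul1r addNr rnorm0 sub0r.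
  have -> : f (- x) = - f x by apply/eqP; rewrite -addr_eq0 -fD addNr sublinear0.
  by rewrite lerN2.
pose v y : R[i]^o := f y +i* (- f ('i%C *: y)).
have lv : linear v := complexify_linear (conj fD fZ).
have vn y : cabs (v y) <= rnorm y.
  have [->|vy0] := eqVneq (v y) 0; first by rewrite cabs0 rnorm_ge0.
  (* The unimodular [u] rotates [v y] onto its modulus, so the bound on the real part [f] bounds the
     modulus as well. *)
  pose u : R[i] := (cabs (v y))%:C / v y.
  have u1 : cabs u = 1.
    by rewrite cabsM cabsV cabsC ger0_norm ?cabs_ge0// divff// cabs_eq0.
  have : v (u *: y) = (cabs (v y))%:C.
    by rewrite (GRing.scalable_linear lv) -[LHS]/(_ * _) divfK.
  move=> /(congr1 (@complex.Re R))/= <-.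
  by rewrite (le_trans (fn _))// rnormZE u1 mul1r.
have vb : v \in is_bounded_linear.
  by apply/asboolP; split=> //; exists 1 => y; rewrite mul1r; exact: vn.
exists (Bop vb); first by apply: opnorm_le => y y1; exact: le_trans (vn y) y1.
rewrite (le_trans fx)// (le_trans (ler_norm _))//.
exact: (Re_le_cabs (v x)).
Qed.

Section Adjoint.
Context {R : realType} {E : normedModType R[i]}.
Implicit Types a b : bop E E.

(** To bound [opnorm b] from above, [adjoint b] is applied to a functional that norms [b x]. *)
Lemma opnorm_adjoint b : opnorm (adjoint b) = opnorm b.
Proof.
apply/eqP; rewrite eq_le; apply/andP; split.
  apply: opnorm_le => v v1.
  apply: opnorm_le => x x1; rewrite (le_trans (ler_opnorm v _))//.
  rewrite (le_trans (ler_piMl (rnorm_ge0 _) v1))//; exact: ler_opnorm_ball.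
apply: opnorm_le => x x1; have [v v1 bxv] := hahn_banach_norming (b x).
rewrite (le_trans bxv)//.
apply: le_trans (ler_opnorm_ball (adjoint b v) x1) _.
exact: (ler_opnorm_ball (adjoint b) v1).
Qed.

Lemma adjointX b n : adjoint b ^+ n = adjoint (b ^+ n).
Proof.
apply: bop_eq => v; apply: bop_eq => x; rewrite bopX /= bopX.
by elim: n x => //= n IH x; rewrite IH -iterSr.
Qed.

End Adjoint.

(** * Vectors with maximal growth *)

Section SlowDecay.
Context {R : realType} {E G : normedModType R[i]}.

Lemma near_norming (f : bop E G) :
  exists2 x, rnorm x <= 1 & opnorm f / 2 <= rnorm (f x).
Proof.
have [f0|f0] := leP (opnorm f) 0.
  exists 0; first by rewrite rnorm0.
  by rewrite (le_trans _ (rnorm_ge0 _))// pmulr_lle0.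
have f2 : 0 < opnorm f / 2 by rewrite divr_gt0.
have [_ [x x1 <-] /ltW fx] := sup_adherent f2 (opnorm_has_sup f).
by exists x => //; rewrite (le_trans _ fx)// -/(opnorm f); lra.
Qed.

(* v is the sum of a series whose j-th term is either 0 or a near-norming
   vector of T j scaled by 16^-j, chosen so that T j does not cancel. *)
Lemma exists_slow_decay (T : nat -> bop E G) : geom_complete E ->
  exists v, forall j, 16^-1 ^+ j / 8 * opnorm (T j) <= rnorm (T j v).
Proof.
move=> E_complete; pose q : R := 16^-1.
have q0 : 0 < q by rewrite invr_gt0.
have q1 : q < 1 by rewrite invf_lt1// ltr1n.
have qX j : 0 < q ^+ j by rewrite exprn_gt0.
have /choice[x xP] : forall j, exists x,
    rnorm x <= 1 /\ opnorm (T j) / 2 <= rnorm (T j x).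
  by move=> j; have [x x1 Tx] := near_norming (T j); exists x.
(* If s fails this test, the new term contributes at least [q ^+ j / 2 * opnorm (T j)], of which s
   cancels less than half. *)
pose good j s := q ^+ j / 4 * opnorm (T j) <= rnorm (T j s).
pose next j s := if good j s then s else s + (q ^+ j)%:C *: x j.
pose s := fix s j := if j is k.+1 then next k (s k) else 0.
have good_next j : good j (s j.+1).
  rewrite /= /next; case: ifPn => // bad.
  have [_ Tx] := xP j; move: bad; rewrite /good -ltNge => bad.
  have -> : T j (s j + (q ^+ j)%:C *: x j) = T j (s j) + (q ^+ j)%:C *: T j (x j).
    by rewrite -linearZ -linearD.
  have := ler_rnorm_sub ((q ^+ j)%:C *: T j (x j)) (- T j (s j)).
  rewrite opprK rnormN rnormZE cabsC ger0_norm ?(ltW (qX j))// (addrC _ (T j (s j))).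
  have := ler_wpM2l (ltW (qX j)) Tx; move: bad; lra.
have sS j : rnorm (s j.+1 - s j) <= 1 * q ^+ j.
  rewrite mul1r /= /next; case: ifP => _; first by rewrite subrr rnorm0 ltW.
  rewrite addrC addKr rnormZE cabsC ger0_norm ?(ltW (qX j))//.
  by rewrite ler_piMr ?(ltW (qX j))//; exact: (xP j).1.
have [v [K vK]] := E_complete s 1 q (ltW q0) q1 sS.
have tail := geometric_tail (ltW q0) q1 sS vK.
exists v => j; rewrite -/q.
have := ler_rnorm_sub (T j (s j.+1)) (T j (s j.+1 - v)).
have -> : T j (s j.+1) - T j (s j.+1 - v) = T j v.
  by rewrite -linearB subKr.
apply: le_trans; rewrite lerBrDl.
(* The later terms add up to at most q^(j+1)/(1-q) = q^j/15, and 1/4 - 1/15 exceeds 1/8. *)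
have Tv : rnorm (T j (s j.+1 - v)) <= opnorm (T j) * (q ^+ j / 15).
  rewrite (le_trans (ler_opnorm _ _))// ler_wpM2l ?opnorm_ge0// rnorm_distC.
  rewrite (le_trans (tail _))// exprS le_eqVlt; apply/orP; left; apply/eqP.
  by rewrite /q; field.
apply: le_trans (good_next j); apply: le_trans (lerD Tv (lexx _)) _.
have := mulr_ge0 (ltW (qX j)) (opnorm_ge0 (T j)); lra.
Qed.

End SlowDecay.

(** * Limits of n-th roots *)

Section RootLimits.
Context {R : realType}.
Implicit Types (y : nat -> R) (r l : R).

Lemma powR_root_le (s x : R) n : (0 < n)%N -> 0 <= s -> 0 <= x -> x <= s ^+ n ->
  x `^ n%:R^-1 <= s.
Proof.
move=> n0 s0 x0 xs; have n0' : n%:R != 0 :> R by rewrite pnatr_eq0 -lt0n.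
have -> : s = (s ^+ n) `^ n%:R^-1.
  by rewrite -powR_mulrn// -powRrM divff// powRr1.
by rewrite ge0_ler_powR// ?invr_ge0// nnegrE exprn_ge0.
Qed.

Lemma powR_root_ge (s x : R) n : (0 < n)%N -> 0 <= s -> s ^+ n <= x ->
  s <= x `^ n%:R^-1.
Proof.
move=> n0 s0 sx; have n0' : n%:R != 0 :> R by rewrite pnatr_eq0 -lt0n.
have -> : s = (s ^+ n) `^ n%:R^-1.
  by rewrite -powR_mulrn// -powRrM divff// powRr1.
by rewrite ge0_ler_powR// ?invr_ge0// nnegrE ?exprn_ge0// (le_trans _ sx)// exprn_ge0.
Qed.

Lemma root_cvg y r : (forall n, 0 <= y n) -> 0 <= r ->
    (forall s, 0 <= s -> s < r -> \forall n \near \oo, s ^+ n <= y n) ->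
    (forall s, r < s -> \forall n \near \oo, y n <= s ^+ n) ->
  y n `^ n%:R^-1 @[n --> \oo] --> r.
Proof.
move=> y0 r0 lo up; apply/cvgrPdist_le => e e0.
(* At n = 0 the exponent [n%:R^-1] is 0, so that index is excluded. *)
have pos : \forall n \near \oo, (0 < n)%N by exists 1%N.
have re : r < r + e by rewrite ltrDl.
have lower : \forall n \near \oo, r - e <= y n `^ n%:R^-1.
  have [re0|re0] := leP 0 (r - e).
    have re' : r - e < r by rewrite gtrBl.
    apply: filterS2 pos (lo _ re0 re') => n n0 yn.
    exact: powR_root_ge.
  by apply: nearW => n; rewrite (le_trans (ltW re0))// powR_ge0.
apply: filterS3 pos lower (up _ re) => n n0 ln yn.
have := @powR_root_le (r + e) (y n) n n0 (addr_ge0 r0 (ltW e0)) (y0 n) yn.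
rewrite ler_distlC => yn'; lra.
Qed.

Lemma root_limit_le y r l : (forall n, 0 <= y n) -> 0 <= r ->
    (forall s, r < s -> \forall n \near \oo, y n <= s ^+ n) ->
  y n `^ n%:R^-1 @[n --> \oo] --> l -> l <= r.
Proof.
move=> y0 r0 up yl; apply/ler_addgt0Pr => e e0.
have pos : \forall n \near \oo, (0 < n)%N by exists 1%N.
have re : r < r + e by rewrite ltrDl.
apply: (cvgr_to_le yl); apply: filterS2 pos (up _ re) => n n0 yn.
by apply: powR_root_le => //; rewrite addr_ge0// ltW.
Qed.

Lemma exists_sqrt m : exists i, (i ^ 2 <= m <= i.+1 ^ 2)%N.
Proof.
elim: m => [|m [i /andP[im mi]]]; first by exists 0%N.
have [mi'|mi'] := leqP m.+1 (i.+1 ^ 2); first by exists i; rewrite mi' ltnW.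
exists i.+1; rewrite (ltnW mi') /=.
by rewrite (leq_ltn_trans mi)// ltn_exp2r.
Qed.

(* Losing a factor d^(sqrt n) does not change an exponential rate. *)
Lemma subexponential_loss (c d p : R) : 0 < c -> 0 < d -> 0 <= p -> p < 1 ->
  \forall m \near \oo, forall i, (i ^ 2 <= m <= i.+1 ^ 2)%N ->
    p ^+ m <= c * d ^+ i.+1.
Proof.
move=> c0 d0 p0 p1.
have cd : 0 < c * d by rewrite mulr_gt0.
have h0 : 0 <= 2^-1 :> R by rewrite invr_ge0.
have h1 : 2^-1 < 1 :> R by rewrite invf_lt1// ltr1n.
(* [N1] gives 2^-i <= c d and [N2] gives p^i <= d/2, whence p^m <= (p^i)^i <= (d/2)^i <= c
   d^(i+1). *)
have [N1 HN1] := expr_small 1 h0 h1 cd.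
have d2 : 0 < d / 2 by rewrite divr_gt0.
have [N2 HN2] := expr_small 1 p0 p1 d2.
exists ((maxn N1 N2).+1 ^ 2)%N => // m /= Nm i /andP[im mi].
have Ni : (maxn N1 N2 <= i)%N.
  by rewrite -ltnS -(@leq_exp2r _ _ 2)// (leq_trans Nm).
have /HN1 : (N1 <= i)%N by rewrite (leq_trans _ Ni)// leq_maxl.
have /HN2 : (N2 <= i)%N by rewrite (leq_trans _ Ni)// leq_maxr.
rewrite !mul1r => pi hi.
apply: (@le_trans _ _ (p ^+ (i ^ 2))); first by rewrite ler_wiXn2l// ltW.
rewrite exprS mulrA -[(i ^ 2)%N]/(i * i)%N exprM.
apply: (@le_trans _ _ ((d / 2) ^+ i)).
  by rewrite lerXn2r// nnegrE ?exprn_ge0// ltW.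
by rewrite exprMn mulrC ler_wpM2r// exprn_ge0// ltW.
Qed.

End RootLimits.

Lemma exp_bounded_upper (R : realType) (E : normedModType R[i]) (T : bop E E)
    (r : R) (v : E) : 0 <= r -> (forall s, r < s -> exp_bounded T s) ->
  forall s, r < s -> \forall n \near \oo, rnorm (iter n T v) <= s ^+ n.
Proof.
(* The midpoint leaves a ratio [s' / s] below 1, whose powers absorb the constant. *)
move=> r0 up s rs; pose s' := (r + s) / 2.
have [s'0 [C TC]] : exp_bounded T s' by apply: up; rewrite /s'; lra.
have s's : s' < s by rewrite /s'; lra.
have s0 : 0 < s by rewrite (le_lt_trans r0).
have q0 : 0 <= s' / s by rewrite divr_ge0// ltW.
have q1 : s' / s < 1 by rewrite ltr_pdivrMr// mul1r.
have [N HN] := expr_small (C * rnorm v) q0 q1 ltr01.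
exists N => // n /= /HN; rewrite expr_div_n mulrA ler_pdivrMr ?exprn_gt0// mul1r.
apply: le_trans; rewrite -bopX (le_trans (ler_opnorm _ _))//.
by rewrite mulrAC ler_wpM2r ?rnorm_ge0.
Qed.

(* Slow decay is only imposed along the squares; the interpolation to all
   times and the factors 16^-j then cost d^(sqrt n) for some d > 0. *)
Lemma growth_rate_attained (R : realType) (E : normedModType R[i])
    (T : bop E E) (r : R) : geom_complete E -> 0 <= r ->
    (forall n, r ^+ n <= opnorm (T ^+ n)) ->
    (forall s, r < s -> exp_bounded T s) ->
  exists2 v, rnorm v = 1 & growth_rate T v r.
Proof.
move=> E_complete r0 lo up.
have [v0 v0P] := exists_slow_decay (fun j => T ^+ (j ^ 2)) E_complete.
(* The estimate at j = 0, where [T ^+ 0] is the identity, shows that [v0] is nonzero and can be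
   normalised. *)
have v0_gt0 : 0 < rnorm v0.
  have := v0P 0%N; rewrite !expr0 bop1; apply: lt_le_trans.
  by rewrite mulr_gt0// (lt_le_trans _ (lo 0%N))// expr0.
have [c c0 [v v1 vP]] : exists2 c : R, 0 < c & exists2 v, rnorm v = 1 &
    forall j, c * 16^-1 ^+ j * opnorm (T ^+ (j ^ 2)) <= rnorm ((T ^+ (j ^ 2)) v).
  exists (8 * rnorm v0)^-1; first by rewrite invr_gt0 mulr_gt0.
  exists ((rnorm v0)^-1%:C *: v0).
    by rewrite rnormZE cabsC ger0_norm ?invr_ge0 ?rnorm_ge0// mulVf// gt_eqF.
  move=> j; have -> : (T ^+ (j ^ 2)) ((rnorm v0)^-1%:C *: v0) =
    (rnorm v0)^-1%:C *: (T ^+ (j ^ 2)) v0 by exact: linearZ.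
  rewrite rnormZE cabsC ger0_norm ?invr_ge0 ?rnorm_ge0//.
  have := ler_wpM2l (ltW (v0_gt0 : 0 < rnorm v0)) (v0P j).
  rewrite ler_pdivlMl// => _; apply: le_trans (v0P j).
  rewrite le_eqVlt; apply/orP; left; apply/eqP; field.
  by rewrite gt_eqF.
exists v => //; apply: root_cvg => //.
- by move=> n; exact: rnorm_ge0.
- move=> s s0 sr; have r_gt0 := le_lt_trans s0 sr.
  (* [K] dominates 1, [opnorm T] and [r^-1]. One factor [K ^+ (2 * j)] pays for going from time m up
     to the square [j ^ 2], another for the surplus [r ^+ e]; hence [K ^+ 4] in the loss per
     step. *)
  pose K := opnorm T + 1 + r^-1.
  have rV : 0 < r^-1 by rewrite invr_gt0.
  have T0 := opnorm_ge0 T.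
  have K1 : 1 <= K by rewrite /K -addrA addrCA lerDl addr_ge0// ltW.
  have K0 : 0 < K by rewrite (lt_le_trans ltr01).
  have d0 : 0 < 16^-1 / K ^+ 4 by rewrite divr_gt0// exprn_gt0.
  have p0 : 0 <= s / r by rewrite divr_ge0.
  have p1 : s / r < 1 by rewrite ltr_pdivrMr// mul1r.
  apply: filterS (subexponential_loss c0 d0 p0 p1) => m loss.
  have [i im] := exists_sqrt m; have := loss i im.
  move: im => /andP[im mi]; set j := i.+1 in mi *.
  pose e := (j ^ 2 - m)%N.
  (* The distance from m to the next square is at most (i+1)^2 - i^2 = 2i + 1. *)
  have ej : (e <= 2 * j)%N.
    rewrite /e leq_subLR (leq_trans _ (leq_add im (leqnn _)))// /j -addn1 sqrnD.
    by rewrite muln1 mulnDr -addnA leq_add2l addnC leq_add2l.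
  have KE : K ^+ e <= K ^+ (2 * j) by rewrite ler_weXn2l.
  have re : 1 <= K ^+ e * r ^+ e.
    by rewrite -exprMn exprn_ege1// -ler_pdivrMr// div1r /K lerDr addr_ge0.
  have je : (j ^ 2 = e + m)%N by rewrite subnK.
  have Te : rnorm ((T ^+ (j ^ 2)) v) <= K ^+ e * rnorm (iter m T v).
    rewrite je exprD bopM (bopX T m) (le_trans (ler_opnorm _ _))//.
    rewrite ler_wpM2r ?rnorm_ge0// (le_trans (opnormX _ _))// lerXn2r// ?nnegrE//.
      exact: ltW.
    by rewrite /K -addrA lerDl addr_ge0// ltW.
  have := le_trans (vP j) Te.
  have cq : 0 < c * 16^-1 ^+ j by rewrite mulr_gt0// exprn_gt0// invr_gt0.
  move=> /(le_trans (ler_wpM2l (ltW cq) (lo _))); rewrite je exprD => main.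
  rewrite expr_div_n ler_pdivrMr ?exprn_gt0// => /le_trans; apply.
  have K2 : 0 < K ^+ (2 * j) by rewrite exprn_gt0.
  have key : c * 16^-1 ^+ j * r ^+ m <= K ^+ (2 * j) * (K ^+ (2 * j) * rnorm (iter m T v)).
    apply: (@le_trans _ _ (K ^+ e * (c * 16^-1 ^+ j * (r ^+ e * r ^+ m)))).
      have -> : K ^+ e * (c * 16^-1 ^+ j * (r ^+ e * r ^+ m)) =
        (K ^+ e * r ^+ e) * (c * 16^-1 ^+ j * r ^+ m) by ring.
      by rewrite ler_peMl// mulr_ge0 ?ltW// exprn_gt0.
    apply: ler_pM => //; first by rewrite exprn_ge0// ltW.
      by rewrite !mulr_ge0// ?exprn_ge0// ltW.
    by rewrite (le_trans main)// ler_wpM2r ?rnorm_ge0.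
  have -> : c * (16^-1 / K ^+ 4) ^+ j * r ^+ m =
      (c * 16^-1 ^+ j * r ^+ m) / (K ^+ (2 * j) * K ^+ (2 * j)).
    rewrite -exprD -mulnDl expr_div_n -exprM; field.
    by rewrite expf_neq0// gt_eqF.
  by rewrite ler_pdivrMr ?mulr_gt0// [leRHS]mulrC -[leRHS]mulrA.
- exact: exp_bounded_upper.
Qed.

Theorem corollary5p6 (R : realType) (F : completeNormedModType R[i])
    (F_neq0 : exists x : F, x != 0) (a : bop F F) :
  is_max_growth_rate (adjoint a) (@unit_sphere R (dual_space F))
    (spectral_radius a) /\
  (reflexive_space F ->
    exists2 v : F, v != 0 & growth_rate a v (spectral_radius a)).
Proof.
have F_complete := @complete_geom_complete R F.
have r0 := spectral_radius_ge0 a.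
(* For n = 0 the claim is that the identity has norm at least 1, which a nonzero vector provides. *)
have lo n : spectral_radius a ^+ n <= opnorm (a ^+ n).
  case: n => [|n]; last exact: spectral_radius_pow_le.
  have [x /rnorm_gt0 x0] := F_neq0.
  have := ler_opnorm (1 : bop F F) x; rewrite bop1 !expr0.
  by rewrite -ler_pdivrMr// divff ?gt_eqF.
have up s : spectral_radius a < s -> exp_bounded a s.
  exact: spectral_radius_exp_bounded.
have adjX n : opnorm (adjoint a ^+ n) = opnorm (a ^+ n).
  by rewrite adjointX opnorm_adjoint.
have upA s : spectral_radius a < s -> exp_bounded (adjoint a) s.
  move=> /up[s0 [C aC]]; split=> //; exists C => n.
  by rewrite adjX.
split; last first.
  (* The direction in [F] comes from the same construction, applied to [a] itself. *)
  move=> _; have [v v1 av] := growth_rate_attained F_complete r0 lo up.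
  by exists v => //; apply: contra_eq_neq v1 => ->; rewrite rnorm0 eq_sym oner_neq0.
split.
  have [n|v v1 av] := growth_rate_attained (@dual_geom_complete R F) r0 _ upA.
    by rewrite adjX.
  by exists v.
(* The exponential bounds on the powers of the adjoint apply to every vector and cap any limit. *)
move=> l [v _ vl]; apply: (root_limit_le _ r0 _ vl) => [n|]; first exact: rnorm_ge0.
exact: exp_bounded_upper r0 upA.
Qed.
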